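(* Let $K$ be a field, let $\mathcal{O}=\{t_1,\dots,t_\mu\}$ be an order ideal in $\mathbb{T}^2$ with border $\partial\mathcal{O}=\{b_1,\dots,b_\nu\}$, let $C=(c_{ij})$, and let $I(\mathbb{B}_{\mathcal{O}})\subseteq K[C]$ be the ideal defining the $\mathcal{O}$-border basis scheme. Then the following claims hold. (a) The residue classes modulo $I(\mathbb{B}_{\mathcal{O}})$ of the exposed indeterminates generate the $K$-algebra $B_{\mathcal{O}}=K[C]/I(\mathbb{B}_{\mathcal{O}})$. (b) Every basic indeterminate is exposed and cannot be contained in a tuple $Z$ of distinct indeterminates in $C$ for which $I(\mathbb{B}_{\mathcal{O}})$ has a $Z$-separating re-embedding.
   Context: $\mathbb{T}^2$ is the set of terms in $x=x_1$, $y=x_2$. An order ideal is a finite set $\mathcal{O}=\{t_1,\dots,t_\mu\}$ ($\mu\ge1$) of terms closed under taking divisors; its border is $\partial\mathcal{O}=(x\mathcal{O}\cup y\mathcal{O})\setminus\mathcal{O}=\{b_1,\dots,b_\nu\}$. Let $c_{ij}$ ($1\le i\le\mu$, $1\le j\le\nu$) be indeterminates, $C=(c_{ij})$, $K[C]=K[c_{11},\dots,c_{\mu\nu}]$. Generic multiplication matrices: $\mathcal{A}_r\in\mathrm{Mat}_\mu(K[C])$ ($r=1,2$) has $(i,j)$ entry $\delta_{im}$ if $x_rt_j=t_m\in\mathcal{O}$ and $c_{im}$ if $x_rt_j=b_m\in\partial\mathcal{O}$. $I(\mathbb{B}_{\mathcal{O}})$ is generated by the entries of $\mathcal{A}_1\mathcal{A}_2-\mathcal{A}_2\mathcal{A}_1$.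 Natural generators of $I(\mathbb{B}_{\mathcal{O}})$: write $\mathbf{c}_j=(c_{1j},\dots,c_{\mu j})^{\rm tr}$. For next-door neighbors $b_j=x_kb_{j'}$, take the entries of $\mathbf{c}_j-\mathcal{A}_k\mathbf{c}_{j'}$; for across-the-rim neighbors $b_j=x_kt_m$, $b_{j'}=x_\ell t_m$ ($k\ne\ell$, $t_m\in\mathcal{O}$), take the entries of $\mathcal{A}_\ell\mathbf{c}_j-\mathcal{A}_k\mathbf{c}_{j'}$. They generate $I(\mathbb{B}_{\mathcal{O}})$. Exposed: $c_{ij}$ is $x_\ell$-exposed if $x_\ell t_i\in\partial\mathcal{O}$ and there is $j'$ such that $b_{j'}=x_\ell b_j$, or $x_kb_{j'}=x_\ell b_j$ for some $k\ne\ell$; $c_{ij}$ is exposed if it is $x$-exposed or $y$-exposed. Basic: $c_{ij}$ is basic if it does not occur in the linear part (homogeneous component of standard degree one) of any natural generator of $I(\mathbb{B}_{\mathcal{O}})$. For a tuple $Z=(z_1,\dots,z_s)$ of distinct indeterminates in $C$, the ideal $I(\mathbb{B}_{\mathcal{O}})$ has a $Z$-separating re-embedding if there are $f_1,\dots,f_s\in I(\mathbb{B}_{\mathcal{O}})$ and a term ordering $\sigma$ on $K[C]$ with $\mathrm{LT}_\sigma(f_i)=z_i$ for all $i$. *)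

(* Defs.v *)
From HB Require Import structures.
From mathcomp Require Import all_boot all_order all_algebra.
From mathcomp Require Import ring_quotient boolp.
From mathcomp.multinomials Require Import mpoly.

Set Implicit Arguments.
Unset Strict Implicit.
Unset Printing Implicit Defensive.

Import GRing.Theory.
Local Open Scope ring_scope.
Local Open Scope quotient_scope.

(* Terms in x and y are exponent vectors; [termM k t] is the term x_k * t. *)
Notation term := 'X_{1..2}.

Definition termM (k : 'I_2) (t : term) : term := (U_(k) + t)%MM.

Definition border_seq (O : seq term) : seq term :=
  [seq u <- [seq termM k t | k <- enum 'I_2, t <- O] | u \notin O].

(* An order ideal with mu elements whose border has nu elements, both numbered
   in an arbitrary way; (v <= u)%MM is divisibility of terms. *)
Record order_ideal (mu nu : nat) := OrderIdeal {
  oterm : mu.-tuple term;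
  bterm : nu.-tuple term;
  oterm_gt0 : (0 < mu)%N;
  oterm_uniq : uniq oterm;
  oterm_div : forall u v : term, u \in oterm -> (v <= u)%MM -> v \in oterm;
  bterm_uniq : uniq bterm;
  bterm_border : bterm =i border_seq oterm
}.

Definition ideal_gen (R : comNzRingType) (I : finType) (g : I -> R) (p : R) : Prop :=
  exists a : I -> R, p = \sum_i a i * g i.

(* [G] generates the K-algebra [A]: no proper subalgebra contains [G]. *)
Definition generates_algebra (K : fieldType) (A : algType K) (G : A -> Prop) : Prop :=
  forall S : {pred A}, subalg_closed S -> (forall x, G x -> x \in S) ->
  forall x, x \in S.

Definition occurs (R : comNzRingType) (n : nat) (k : 'I_n) (p : {mpoly R[n]}) : bool :=
  has (fun m : 'X_{1..n} => 0 < m k)%N (msupp p).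

(* For a total order compatible with multiplication, minimality of 1 is
   equivalent to being a well-ordering (Dickson's lemma). *)
Definition term_ordering (n : nat) (le : rel 'X_{1..n}) : Prop :=
  [/\ antisymmetric le, transitive le, total le,
      forall m, le 0%MM m &
      forall m m1 m2, le m1 m2 -> le (m + m1)%MM (m + m2)%MM].

Definition leading_term (R : comNzRingType) (n : nat) (le : rel 'X_{1..n})
    (p : {mpoly R[n]}) (m : 'X_{1..n}) : Prop :=
  m \in msupp p /\ {in msupp p, forall m', le m' m}.

Section BorderBasisScheme.

Variables (K : fieldType) (mu nu : nat) (O : order_ideal mu nu).

Local Notation t := (tnth (oterm O)).
Local Notation b := (tnth (bterm O)).

(* The indeterminates c_ij are numbered by 'I_(mu * nu) through mxvec_index. *)
Local Notation KC := {mpoly K[mu * nu]}.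

Definition Cmx : 'M[KC]_(mu, nu) := \matrix_(i, j) 'X_(mxvec_index i j).

(* The last branch never occurs: x_r * t_j lies in the order ideal or its border. *)
Definition mulmatrix (r : 'I_2) : 'M[KC]_mu :=
  \matrix_(i, j)
    if [pick m | termM r (t j) == t m] is Some m then (i == m)%:R
    else if [pick m | termM r (t j) == b m] is Some m then Cmx i m
    else 0.

Definition commutator : 'M[KC]_mu :=
  mulmatrix 0 *m mulmatrix 1 - mulmatrix 1 *m mulmatrix 0.

Definition border_ideal : pred KC :=
  fun p => `[< ideal_gen (fun ij : 'I_mu * 'I_mu => commutator ij.1 ij.2) p >].

(* At C = 0 the multiplication matrices commute, hence the ideal is proper. *)
Lemma mulmatrix_coef0 (r : 'I_2) (i j : 'I_mu) :
  (mulmatrix r i j)@_0%MM = (t i == termM r (t j))%:R.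
Proof.
rewrite mxE; case: pickP => [m /eqP e|nt].
  rewrite e (inj_eq (tuple_uniqP _ (oterm_uniq O))).
  by case: (i == m); rewrite ?mcoeff1 ?mcoeff0 ?eqxx.
have -> : (t i == termM r (t j)) = false by rewrite eq_sym nt.
case: pickP => [m _|_]; last by rewrite mcoeff0.
by rewrite mxE mcoeffX mnm1_eq0.
Qed.

Lemma mulmatrixM_coef0 (r s : 'I_2) (i j : 'I_mu) :
  ((mulmatrix r *m mulmatrix s) i j)@_0%MM
    = (t i == termM r (termM s (t j)))%:R.
Proof.
rewrite mxE raddf_sum /=.
under eq_bigr => k _ do rewrite rmorphM /= !mulmatrix_coef0.
case: (boolP (termM s (t j) \in oterm O)) => [/tnthP[k ek]|nin].
  rewrite (bigD1 k) //= big1 ?addr0 => [|k' ne].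
    by rewrite -ek eqxx mulr1.
  by rewrite ek (inj_eq (tuple_uniqP _ (oterm_uniq O))) (negPf ne) mulr0.
rewrite big1 => [|k _].
  case: eqP => // e; case/negP: nin.
  apply: (oterm_div (mem_tnth i (oterm O))); rewrite e.
  by apply/mnm_lepP => q; rewrite /termM [in X in (_ <= X)%N]mnmDE leq_addl.
case: eqP => [_|_]; case: eqP => [e|_]; rewrite ?mulr0 ?mul0r //.
by case/negP: nin; rewrite -e mem_tnth.
Qed.

Lemma commutator_coef0 (i j : 'I_mu) : (commutator i j)@_0%MM = 0.
Proof.
have e01 := mulmatrixM_coef0 0 1 i j; have e10 := mulmatrixM_coef0 1 0 i j.
rewrite mxE [in X in _ + X]mxE mcoeffB e01 e10 /termM !addmA.
by rewrite [X in (X + _)%MM]addmC subrr.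
Qed.

Lemma border_ideal_closed : idealr_closed border_ideal.
Proof.
split.
- by apply/asboolP; exists (fun=> 0); rewrite big1 // => i _; rewrite mul0r.
- apply/negP => /asboolP[a /(congr1 (mcoeff 0))].
  rewrite mcoeff1 eqxx raddf_sum /= big1 => [/eqP|i _].
    by rewrite oner_eq0.
  by rewrite rmorphM /= commutator_coef0 mulr0.
- move=> a u v /asboolP[p ->] /asboolP[q ->]; apply/asboolP.
  exists (fun i => a * p i + q i); rewrite mulr_sumr -big_split.
  by apply: eq_bigr => i _ /=; rewrite mulrDl mulrA.
Qed.

HB.instance Definition _ := isIdealr.Build KC border_ideal border_ideal_closed.

Definition coordinate_ring := {ideal_quot (Idealr.clone KC border_ideal _)}.

HB.instance Definition _ := GRing.ComNzRing.on coordinate_ring.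
HB.instance Definition _ := NzRingQuotient.on coordinate_ring.

Definition residue (p : KC) : coordinate_ring := \pi_coordinate_ring p.

Lemma residueE (p q : KC) : (residue p == residue q) = (p - q \in border_ideal).
Proof. by rewrite -Quotient.idealrBE. Qed.

Lemma residue_surj (x : coordinate_ring) : exists p : KC, x = residue p.
Proof. by exists (repr (x : coordinate_ring)); rewrite /residue reprK. Qed.

Lemma residue_is_zmod_morphism : zmod_morphism residue.
Proof. exact: (raddfB (\pi_coordinate_ring)). Qed.

Lemma residue_is_monoid_morphism : monoid_morphism residue.
Proof.
split; first exact: (rmorph1 (\pi_coordinate_ring)).
exact: (rmorphM (\pi_coordinate_ring)).
Qed.

HB.instance Definition _ :=
  GRing.isZmodMorphism.Build KC coordinate_ring residue residue_is_zmod_morphism.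
HB.instance Definition _ :=
  GRing.isMonoidMorphism.Build KC coordinate_ring residue residue_is_monoid_morphism.

Definition coord_scale (a : K) (x : coordinate_ring) : coordinate_ring :=
  residue a%:MP * x.

Lemma coord_scaleA a b' x : coord_scale a (coord_scale b' x) = coord_scale (a * b') x.
Proof. by rewrite /coord_scale mulrA -rmorphM -mpolyCM. Qed.

Lemma coord_scale1 : left_id 1 coord_scale.
Proof. by move=> x; rewrite /coord_scale rmorph1 mul1r. Qed.

Lemma coord_scaleDr : right_distributive coord_scale +%R.
Proof. by move=> a x y; rewrite /coord_scale mulrDr. Qed.

Lemma coord_scaleDl x : {morph coord_scale^~ x : a b' / a + b'}.
Proof. by move=> a b'; rewrite /coord_scale mpolyCD rmorphD mulrDl. Qed.

HB.instance Definition _ := GRing.Zmodule_isLmodule.Build K coordinate_ring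
  coord_scaleA coord_scale1 coord_scaleDr coord_scaleDl.

Lemma coord_scaleAl (a : K) (x y : coordinate_ring) : a *: (x * y) = a *: x * y.
Proof. exact: mulrA. Qed.

HB.instance Definition _ :=
  GRing.Lmodule_isLalgebra.Build K coordinate_ring coord_scaleAl.

Lemma coord_scaleAr (a : K) (x y : coordinate_ring) : a *: (x * y) = x * (a *: y).
Proof. exact: mulrCA. Qed.

HB.instance Definition _ :=
  GRing.Lalgebra_isAlgebra.Build K coordinate_ring coord_scaleAr.

Lemma residue_is_scalable : scalable residue.
Proof. by move=> a p; rewrite -mul_mpolyC rmorphM. Qed.

HB.instance Definition _ :=
  GRing.isScalable.Build K KC coordinate_ring *:%R residue residue_is_scalable.

Definition next_door (j j' : 'I_nu) (k : 'I_2) : Prop :=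
  b j = termM k (b j').

Definition across_rim (j j' : 'I_nu) (k l : 'I_2) : Prop :=
  k != l /\ exists m : 'I_mu, b j = termM k (t m) /\ b j' = termM l (t m).

Definition natural_generator (p : KC) : Prop :=
  (exists j j' k i,
      next_door j j' k /\ p = (col j Cmx - mulmatrix k *m col j' Cmx) i 0)
  \/ (exists j j' k l i,
      across_rim j j' k l /\
      p = (mulmatrix l *m col j Cmx - mulmatrix k *m col j' Cmx) i 0).

Definition dir_exposed (l : 'I_2) (i : 'I_mu) (j : 'I_nu) : Prop :=
  termM l (t i) \in bterm O /\
  exists j' : 'I_nu, b j' = termM l (b j) \/
    exists k : 'I_2, k != l /\ termM k (b j') = termM l (b j).

Definition exposed (i : 'I_mu) (j : 'I_nu) : Prop :=
  exists l : 'I_2, dir_exposed l i j.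

Definition basic (i : 'I_mu) (j : 'I_nu) : Prop :=
  forall p : KC, natural_generator p ->
    ~~ occurs (mxvec_index i j) (pihomog mdeg 1 p).

Definition separating_reembedding (s : nat) (Z : s.-tuple ('I_mu * 'I_nu)) : Prop :=
  exists (f : 'I_s -> KC) (le : rel 'X_{1..mu * nu}),
    [/\ forall r, f r \in border_ideal, term_ordering le &
     forall r, leading_term le (f r)
                 U_(mxvec_index (tnth Z r).1 (tnth Z r).2)%MM].

End BorderBasisScheme.

(* Main.v *)
Require Import Defs.
From HB Require Import structures.
From mathcomp Require Import all_boot all_order all_algebra.
From mathcomp Require Import boolp ring.
From mathcomp.multinomials Require Import mpoly.

(** Why the theorem holds.

    (a) Let R be a commutative ring in which the multiplication matrices
    commute, and let S be a subring containing the exposed coefficients.  Work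
    with the border basis polynomials g_j = b_j - sum_i c_ij t_i in R[y][x].
    Each pair of neighbouring border terms gives a syzygy of the g_j: multiply
    by the relevant variables and subtract, so that the border terms cancel;
    the remaining terms of the ideal are x_k t_p with x_k t_p in the border,
    each rewritten by one g_n, and the coefficients with which this happens
    are exposed ones.  The generators of an ideal of codimension two are the
    maximal minors of their syzygy matrix (Hilbert-Burch), so the coefficients
    of the g_j are polynomials in the exposed ones.

    Only an explicit form of this principle is used.  Call b_j a column top if
    b_j / y lies in the order ideal; there is one column top of x-degree a for
    every a < w, where x^w is the power of x in the border.  Let g be the
    border basis polynomial of x^w.  Syzygies along vertical walls of the
    border write every g_j as a combination, over S[y], of g and of the
    polynomials of the column tops (yspan_border_poly); the other syzygies do
    this for x times the polynomial of a column top (yspan_xtop).  Hence the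
    column G of these polynomials satisfies (x - M) G = g v with M and v over
    S[y].  With chi the characteristic polynomial of M, Cramer's rule puts
    chi G, and so chi times the whole ideal of the g_j, inside (g).  By
    Cayley-Hamilton for multiplication by y, that ideal contains a polynomial
    in y alone which is monic.  It is regular modulo g, since g is monic in x,
    so g divides chi; both are monic of degree w in x, hence chi = g
    (monic_eq_of_multiple).  Thus g has its coefficients in S, cancelling g in
    chi G = g adj(x - M) v gives the same for the column tops, and then all
    the g_j follow.

    (b) Every b_j is x_l u with u in the order ideal, and the border continues
    from b_j in the other direction x_k, with a next-door or an across-the-rim
    neighbour.  If x_k t_i were in the order ideal, the
    natural generator of this pair in the row of x_k t_i would contain c_ij
    linearly.  So for a basic c_ij the term x_k t_i is in the border, which
    makes c_ij exposed.  Furthermore every entry of the commutator is zero or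
    a natural generator up to sign, and has no constant term, so the linear
    part of any element of the ideal is a combination of linear parts of
    natural generators.  A basic indeterminate occurs in none of them, hence
    is not a term, let alone the leading term, of an element of the ideal. *)

Set Implicit Arguments.
Unset Strict Implicit.
Unset Printing Implicit Defensive.

Import GRing.Theory.
Local Open Scope ring_scope.

(** * Polynomials over commutative rings *)

(** The coefficient ring may have zero divisors, so uniqueness of division by
    the monic g replaces degrees over a field: d (f - g) is a multiple of g of
    smaller degree, and d is regular. *)
Lemma monic_eq_of_multiple (R : comNzRingType) (d : {poly R})
    (f g q : {poly {poly R}}) :
  d \is monic -> f \is monic -> g \is monic -> size f = size g ->
  d%:P * f = q * g -> f = g.
Proof.
move=> md mf mg sfg e.
have eD : d%:P * (f - g) = (q - d%:P) * g by rewrite mulrBr e mulrBl.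
have lt_fg : (size (f - g)%R < size g)%N.
  have g0 : (0 < size g)%N by rewrite size_poly_gt0 monic_neq0.
  rewrite -(prednK g0) ltnS; apply/leq_sizeP => i; rewrite leq_eqVlt.
  case/predU1P => [<-|lti]; rewrite coefB.
    have -> : g`_(size g).-1 = 1 by apply/eqP; rewrite -monicE.
    have -> : f`_(size g).-1 = 1 by rewrite -sfg; apply/eqP; rewrite -monicE.
    by rewrite subrr.
  rewrite !nth_default ?subrr //; first by rewrite -(prednK g0).
  by rewrite sfg -(prednK g0).
have q0 : q - d%:P = 0.
  apply/eqP/contraT => nz.
  have := size_proper_mul (p := q - d%:P) (q := g).
  rewrite (monicP mg) mulr1 lead_coef_eq0 => /(_ nz) => sz.
  have : (size g <= size ((q - d%:P) * g)%R)%N.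
    by rewrite sz -[X in (_ <= (X + _).-1)%N](prednK (n := size (q - d%:P)%R))
         ?size_poly_gt0 // addSn /= leq_addl.
  rewrite -eD mul_polyC => /leq_trans /(_ (size_scale_leq _ _)).
  by rewrite leqNgt lt_fg.
move: eD; rewrite q0 mul0r => e0; apply/eqP; rewrite -subr_eq0; apply/eqP.
apply/polyP => i; rewrite coef0; apply/(monic_rreg md).
by rewrite mul0r mulrC -coefCM e0 coef0.
Qed.

Lemma rpred_det (T : comNzRingType) (P : subringClosed T) n (M : 'M[T]_n) :
  (forall i j, M i j \in P) -> \det M \in P.
Proof.
move=> MP; apply: rpred_sum => s _; rewrite rpredMsign.
by apply: rpred_prod.
Qed.

Lemma rpred_adj (T : comNzRingType) (P : subringClosed T) n (M : 'M[T]_n) i j :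
  (forall i j, M i j \in P) -> (\adj M) i j \in P.
Proof.
move=> MP; rewrite mxE /cofactor -signr_odd rpredMsign.
by apply: rpred_det => i' j'; rewrite !mxE.
Qed.

Section PolySubring.

Variables (R : comNzRingType) (S : subringClosed R).

(** A name for the predicate makes it again a subring, so that the
    construction can be iterated for polynomials in two variables. *)
Definition poly_subring : {pred {poly R}} := polyOver S.

Lemma poly_subring_closed : GRing.subring_closed poly_subring.
Proof.
split=> [|p q pS qS|p q pS qS]; rewrite /poly_subring.
- exact: rpred1.
- exact: rpredB.
- exact: rpredM.
Qed.

HB.instance Definition _ :=
  GRing.isSubringClosed.Build {poly R} poly_subring poly_subring_closed.

End PolySubring.

(** Leibniz rule: the coefficient of an indeterminate is the value at 0 of the
    corresponding partial derivative. *)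
Lemma mcoeffU_mul n (R : comNzRingType) (k : 'I_n) (p q : {mpoly R[n]}) :
  (p * q)@_U_(k) = p@_U_(k) * q@_0 + p@_0 * q@_U_(k).
Proof.
have dE (r : {mpoly R[n]}) : r@_U_(k) = (r^`M(k))@_0.
  by rewrite mcoeff_deriv mnm0E mulr1n add0m.
by rewrite !dE mderivM mcoeffD !rmorphM.
Qed.

Lemma mcoeff_pihomog n (R : nzRingType) d (p : {mpoly R[n]}) m :
  (pihomog mdeg d p)@_m = if mdeg m == d then p@_m else 0.
Proof.
elim/mpolyind: p => [|a m' p _ _ IH]; first by rewrite pihomog0 mcoeff0 if_same.
rewrite pihomogD linearZ /= pihomogX !mcoeffD !mcoeffZ IH.
have -> : (if mdeg m' == d then 'X_[R, m'] else 0)@_m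
          = if mdeg m == d then 'X_[R, m']@_m else 0.
  rewrite (fun_if (mcoeff m)) mcoeff0 mcoeffX.
  by case: (m' =P m) => [->|_]; rewrite ?if_same.
by case: ifP => _; rewrite ?mulr0 ?addr0.
Qed.

Lemma linear_coef0 n (R : comNzRingType) (k : 'I_n) (p : {mpoly R[n]}) :
  ~~ occurs k (pihomog mdeg 1 p) -> p@_U_(k) = 0.
Proof.
apply: contraNeq => nz; apply/hasP; exists U_(k)%MM.
  by rewrite mcoeff_msupp mcoeff_pihomog mdeg1.
by rewrite mnm1E eqxx.
Qed.

(** * The border of an order ideal in two variables *)

Section OrderIdeal.

Variables (mu nu : nat) (O : order_ideal mu nu).
Local Notation t := (tnth (oterm O)).
Local Notation b := (tnth (bterm O)).

Lemma termME k u (i : 'I_2) : termM k u i = ((k == i) + u i)%N.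
Proof. by rewrite /termM mnmDE mnm1E. Qed.

Lemma termMC k l u : termM k (termM l u) = termM l (termM k u).
Proof. by apply/mnmP => i; rewrite !termME addnCA. Qed.

Lemma termM_inj k : injective (termM k).
Proof.
by move=> u v e; apply/mnmP => i; move/mnmP/(_ i): e; rewrite !termME => /addnI.
Qed.

Lemma termM_neq k u : termM k u != u.
Proof.
by apply/eqP => /mnmP/(_ k); rewrite termME eqxx -[X in _ = X]add0n => /addIn.
Qed.

Lemma termM_inj_var u : injective (termM^~ u).
Proof.
move=> k l /mnmP/(_ k); rewrite !termME eqxx => /addIn.
by case: eqP.
Qed.

Lemma oterm_inj : injective t.
Proof. exact/tuple_uniqP/oterm_uniq. Qed.

Lemma bterm_inj : injective b.
Proof. exact/tuple_uniqP/bterm_uniq. Qed.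

Lemma oterm_termM k u : termM k u \in oterm O -> u \in oterm O.
Proof.
by move/oterm_div; apply; apply/mnm_lepP => i; rewrite termME leq_addl.
Qed.

Lemma bterm_notin j : b j \notin oterm O.
Proof.
by have := mem_tnth j (bterm O); rewrite bterm_border mem_filter => /andP[].
Qed.

Lemma btermP u :
  reflect (u \notin oterm O /\ exists k, exists2 v, v \in oterm O & u = termM k v)
          (u \in bterm O).
Proof.
rewrite bterm_border mem_filter; apply: (iffP andP) => -[nu_ h]; split=> //.
  by case/allpairsP: h => -[k v] /= [_ vO ->]; exists k, v.
case: h => k [v vO ->]; apply/allpairsP; exists (k, v).
by rewrite mem_enum.
Qed.

Lemma btermE j : exists k, exists2 v, v \in oterm O & b j = termM k v.
Proof. by have /btermP[] := mem_tnth j (bterm O). Qed.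

Lemma termM_bterm k u :
  u \in oterm O -> termM k u \notin oterm O -> exists n, termM k u = b n.
Proof. by move=> uO nO; apply/tnthP/btermP; split=> //; exists k, u. Qed.

Lemma termM_otermP k u : u \in oterm O ->
  (exists m, termM k u = t m) \/ (exists n, termM k u = b n).
Proof.
move=> uO; have [/tnthP h|h] := boolP (termM k u \in oterm O); first by left.
by right; apply: termM_bterm.
Qed.

Lemma ord2_neq (k l q : 'I_2) : k != l -> q != l -> q = k.
Proof.
move=> h1 h2; apply/val_inj; move: h1 h2; rewrite -!val_eqE /=.
by case: k l q => [[|[|k]] ?] [[|[|l]] ?] [[|[|q]] ?].
Qed.

(** From a border term resting on the order ideal in direction l, the border
    goes on in direction k: to a next-door neighbour if x_k u is still in the
    order ideal, across the rim otherwise. *)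
Lemma border_step (k l : 'I_2) j u :
  u \in oterm O -> b j = termM l u ->
  exists j', b j' = termM k (b j) \/ b j' = termM k u.
Proof.
move=> uO ej; have [h|nh] := boolP (termM k u \in oterm O); last first.
  by have [n en] := termM_bterm uO nh; exists n; right.
have [|n en] := termM_bterm (k := l) h.
  rewrite termMC -ej; apply/negP => /oterm_termM.
  by apply/negP/bterm_notin.
by exists n; left; rewrite -en ej termMC.
Qed.

(** Below two next-door neighbours lie two terms of the order ideal that are
    neighbours as well; commutativity on the first of these is the natural
    generator of the pair. *)
Lemma next_door_square (k l : 'I_2) j j' : k != l -> b j = termM k (b j') ->
  exists2 u, termM k u \in oterm O & b j' = termM l u.
Proof.
move=> kl e; have [q [v vO ev]] := btermE j.
have ql : q = l.
  apply: (@ord2_neq l k); first by rewrite eq_sym.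
  apply: contraTneq vO => qk; move: ev; rewrite e qk => /termM_inj <-.
  exact: bterm_notin.
move: ev; rewrite ql e => ev.
have v0 : (0 < v k)%N.
  by move/mnmP/(_ k): ev; rewrite !termME eqxx eq_sym (negPf kl) add1n add0n => <-.
pose u := (v - U_(k))%MM.
have vu : v = termM k u.
  by apply/mnmP => i; rewrite termME mnmBE mnm1E; case: eqP => [<-|//] /=;
     rewrite ?subn0 // subnKC.
exists u; first by rewrite -vu.
by apply/(@termM_inj k); rewrite ev vu termMC.
Qed.

Definition xyterm (a c : nat) : term := (U_(0%R) *+ a + U_(1%R) *+ c)%MM.

Lemma xyterm0 a c : xyterm a c 0%R = a.
Proof. by rewrite mnmDE !mulmnE !mnm1E /= mul1n mul0n addn0. Qed.

Lemma xyterm1 a c : xyterm a c 1%R = c.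
Proof. by rewrite mnmDE !mulmnE !mnm1E /= mul1n mul0n. Qed.

Lemma mnm2P (u v : term) : u 0 = v 0 -> u 1 = v 1 -> u = v.
Proof.
move=> e0 e1; apply/mnmP => i.
by have [->|n0] := eqVneq i 0; rewrite // (@ord2_neq 1 0 i).
Qed.

Lemma xytermE (u : term) : u = xyterm (u 0) (u 1).
Proof. by apply: mnm2P; rewrite ?xyterm0 ?xyterm1. Qed.

Lemma termM0_xyterm a c : termM 0 (xyterm a c) = xyterm a.+1 c.
Proof. by apply: mnm2P; rewrite termME ?xyterm0 ?xyterm1. Qed.

Lemma termM1_xyterm a c : termM 1 (xyterm a c) = xyterm a c.+1.
Proof. by apply: mnm2P; rewrite termME ?xyterm0 ?xyterm1. Qed.

Lemma xyterm_down a c a' c' : (a' <= a)%N -> (c' <= c)%N ->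
  xyterm a c \in oterm O -> xyterm a' c' \in oterm O.
Proof.
move=> ha hc /oterm_div; apply; apply/mnm_lepP => i.
have [->|n0] := eqVneq i 0; first by rewrite !xyterm0.
by rewrite (@ord2_neq 1 0 i) // !xyterm1.
Qed.

Lemma one_in_oterm : xyterm 0 0 \in oterm O.
Proof.
have /= := mem_tnth (Ordinal (oterm_gt0 O)) (oterm O).
by rewrite [X in X \in _]xytermE; apply: xyterm_down.
Qed.

Lemma oterm_bound u : u \in oterm O -> (mdeg u <= \max_i mdeg (t i))%N.
Proof. by case/tnthP => i ->; apply: (leq_bigmax (F := fun i => mdeg (t i))). Qed.

Lemma xyterm_bound a c : xyterm a c \in oterm O ->
  (a + c <= \max_i mdeg (t i))%N.
Proof. by move/oterm_bound; rewrite mdegD !mdegMn !mdeg1 !mul1n. Qed.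

(** The column tops are the border terms divisible by y with quotient in the
    order ideal.  What matters below is that they are indexed by w
    elements, where x^w, the rightmost border term, is the leading term in x of
    its border basis polynomial, and that x^w is the one border term from which
    the border cannot be followed down or to the right. *)
Lemma column_tops : exists w (j0 : 'I_nu) (top : 'I_w -> 'I_nu),
  [/\ b j0 = xyterm w 0,
      forall u, u \in oterm O -> (u 0%R < w)%N,
      forall a, exists2 u, u \in oterm O & b (top a) = termM 1 u,
      forall j u, u \in oterm O -> b j = termM 1 u -> exists a, j = top a &
      forall j, b j 1 = 0%N -> j = j0].
Proof.
pose B := \max_i mdeg (t i).
have exw : exists a, xyterm a 0 \notin oterm O.
  by exists B.+1; apply/negP => /xyterm_bound; rewrite addn0 ltnn.
case: (ex_minnP exw) => -[|w]; first by rewrite one_in_oterm.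
move=> wO minw.
have inw u : u \in oterm O -> (u 0%R < w.+1)%N.
  move=> uO; rewrite ltnNge; apply: contra wO => le.
  by rewrite [u]xytermE in uO; apply: xyterm_down uO.
have w'O a : (a < w.+1)%N -> xyterm a 0 \in oterm O.
  by move=> lt; apply: contraTT lt => /minw; rewrite -leqNgt.
have [j0 ej0] : exists j0, xyterm w.+1 0 = b j0.
  rewrite -termM0_xyterm; apply: termM_bterm; first exact: w'O.
  by rewrite termM0_xyterm.
have ex_top (a : 'I_w.+1) : exists j,
    (exists2 u, u \in oterm O & b j = termM 1 u) /\ b j 0 = a.
  have exh : exists c, xyterm a c \notin oterm O.
    exists B.+1; apply/negP => /xyterm_bound; rewrite -/B => h.
    by have := leq_trans (leq_addl a B.+1) h; rewrite ltnn.
  case: (ex_minnP exh) => -[|c]; first by rewrite w'O.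
  move=> cO minc.
  have c'O : xyterm a c \in oterm O.
    by apply/negPn/negP => /minc; rewrite ltnn.
  have [j ej] : exists j, termM 1 (xyterm a c) = b j.
    by apply: termM_bterm; rewrite ?termM1_xyterm.
  exists j; split; first by exists (xyterm a c).
  by rewrite -ej termM1_xyterm xyterm0.
have [top topP] := fin_all_exists ex_top.
exists w.+1, j0, top; split=> // [a||].
- by have [] := topP a.
- move=> j u uO ej; exists (Ordinal (inw _ uO)).
  have [[v vO ev] e0] := topP (Ordinal (inw _ uO)).
  apply: bterm_inj; rewrite ej ev; congr termM.
  have uv0 : u 0 = v 0 by rewrite -[LHS]e0 ev termME.
  apply: mnm2P => //; apply/eqP; rewrite eqn_leq; apply/andP; split.
    rewrite leqNgt; apply/negP => lt.
    have := bterm_notin (top (Ordinal (inw _ uO))); case/negP.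
    rewrite ev [v]xytermE termM1_xyterm.
    by move: (uO); rewrite [X in X \in _]xytermE; apply: xyterm_down; rewrite ?uv0.
  rewrite leqNgt; apply/negP => lt; have := bterm_notin j.
  case/negP; rewrite ej [u]xytermE termM1_xyterm.
  by move: (vO); rewrite [X in X \in _]xytermE; apply: xyterm_down; rewrite ?uv0.
move=> j ej; have [k [v vO ev]] := btermE j.
apply: bterm_inj; rewrite -ej0; apply: mnm2P; rewrite ?xyterm0 ?xyterm1 //.
have k0 : k = 0.
  apply: (@ord2_neq 0 1) => //; apply/eqP => k1; move: ej.
  by rewrite ev k1 termME.
apply/eqP; rewrite eqn_leq ev k0 termME /= inw //= add1n.
rewrite ltnNge; apply/negP => le; have := bterm_notin j; case/negP.
by rewrite [b j]xytermE ej; apply: w'O; rewrite ev k0 termME /= add1n.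
Qed.

End OrderIdeal.

(** * Multiplication matrices of a border basis *)

Section MultiplicationMatrices.

Variables (mu nu : nat) (O : order_ideal mu nu) (R : comNzRingType).
Variable c : 'M[R]_(mu, nu).
Local Notation t := (tnth (oterm O)).
Local Notation b := (tnth (bterm O)).

(** The generic multiplication matrix specialised to coefficients in an
    arbitrary ring; it applies both to the indeterminates and to their residue
    classes. *)
Definition border_mulmx (r : 'I_2) : 'M[R]_mu :=
  \matrix_(i, j)
    if [pick m | termM r (t j) == t m] is Some m then (i == m)%:R
    else if [pick m | termM r (t j) == b m] is Some m then c i m
    else 0.

Lemma col_border_mulmx_in k p m :
  termM k (t p) = t m -> col p (border_mulmx k) = delta_mx m 0.
Proof.
move=> e; apply/matrixP => i j; rewrite ord1 !mxE eqxx andbT.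
case: pickP => [m'|/(_ m)]; rewrite e ?eqxx // => /eqP em'.
by rewrite (oterm_inj em').
Qed.

Lemma col_border_mulmx_out k p n :
  termM k (t p) = b n -> col p (border_mulmx k) = col n c.
Proof.
move=> e; apply/matrixP => i j; rewrite !mxE.
case: pickP => [m /eqP em|_].
  by have := bterm_notin O n; rewrite -e em mem_tnth.
case: pickP => [m'|/(_ n)]; rewrite e ?eqxx // => /eqP em'.
by rewrite (bterm_inj em').
Qed.

Lemma col_mulmx m1 m2 m3 p (X : 'M[R]_(m1, m2)) (Y : 'M[R]_(m2, m3)) :
  col p (X *m Y) = X *m col p Y.
Proof. by rewrite !colE mulmxA. Qed.

Lemma col_mul_border_in k p m (X : 'M[R]_mu) :
  termM k (t p) = t m -> col p (X *m border_mulmx k) = col m X.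
Proof. by move=> e; rewrite col_mulmx (col_border_mulmx_in e) -colE. Qed.

Lemma col_mul_border_out k p n (X : 'M[R]_mu) :
  termM k (t p) = b n -> col p (X *m border_mulmx k) = X *m col n c.
Proof. by move=> e; rewrite col_mulmx (col_border_mulmx_out e). Qed.

(** The two products follow the two ways around the square t_p, x_k t_p,
    x_l t_p = b_j', b_j. *)
Lemma commutator_next_door k l j j' : k != l -> b j = termM k (b j') ->
  exists p, col p (border_mulmx l *m border_mulmx k) = col j c /\
            col p (border_mulmx k *m border_mulmx l)
              = border_mulmx k *m col j' c.
Proof.
move=> kl e; have [u kuO eu] := next_door_square kl e.
have /tnthP[p ep] := oterm_termM kuO.
have /tnthP[m em] := kuO.
exists p; split; last by apply: col_mul_border_out; rewrite -ep eu.
rewrite (@col_mul_border_in _ _ m) -?ep //.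
by apply: col_border_mulmx_out; rewrite -em termMC -eu.
Qed.

Lemma commutator_across_rim k l p j j' :
  b j = termM k (t p) -> b j' = termM l (t p) ->
  col p (border_mulmx l *m border_mulmx k) = border_mulmx l *m col j c /\
  col p (border_mulmx k *m border_mulmx l) = border_mulmx k *m col j' c.
Proof. by move=> ej ej'; split; apply: col_mul_border_out. Qed.

End MultiplicationMatrices.

Section BorderBasis.

Variables (mu nu : nat) (O : order_ideal mu nu) (R : comNzRingType).
Variables (c : 'M[R]_(mu, nu)) (S : subringClosed R).
Local Notation t := (tnth (oterm O)).
Local Notation b := (tnth (bterm O)).
Local Notation A := (border_mulmx O c).
Local Notation B := {poly {poly R}}.

(* Commutation says that c is the coefficient matrix of a border basis. *)
Hypothesis commA : A 0 *m A 1 = A 1 *m A 0.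
Hypothesis exposed_in : forall i j, exposed O i j -> c i j \in S.

Lemma mulmx_comm_dir k l : A k *m A l = A l *m A k.
Proof.
have [->|kl] := eqVneq k l; first by [].
have [k0|k0] := eqVneq k 0.
  have -> : l = 1 by apply: (@ord2_neq 1 0); rewrite // -k0 eq_sym.
  by rewrite k0.
have k1 : k = 1 by apply: (@ord2_neq 1 0).
have -> : l = 0 by apply: (@ord2_neq 0 1); rewrite // -k1 eq_sym.
by rewrite k1.
Qed.

Lemma col_next_door k j j' : b j = termM k (b j') -> col j c = A k *m col j' c.
Proof.
have [l kl] : exists l, k != l.
  by case: (eqVneq k 0) => [->|k0]; [exists 1 | exists 0].
move=> /(commutator_next_door c kl) [p [<- <-]].
by rewrite mulmx_comm_dir.
Qed.

Lemma col_across_rim k l p j j' : b j = termM k (t p) -> b j' = termM l (t p) ->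
  A l *m col j c = A k *m col j' c.
Proof.
move=> ej ej'; have [<- <-] := commutator_across_rim c ej ej'.
by rewrite mulmx_comm_dir.
Qed.

(** The outer variable is x and the inner one y: matrices over R[y] then have
    characteristic polynomials in x, and the border basis polynomial of the
    border term x^w is monic. *)
Definition term_poly (u : term) : B := 'X^(u 0) * ('X^(u 1))%:P.

Definition polyCC (a : R) : B := a%:P%:P.

Definition comb_poly (v : 'cV[R]_mu) : B :=
  \sum_i polyCC (v i 0) * term_poly (t i).

Definition border_poly j : B := term_poly (b j) - comb_poly (col j c).

(** The defect of the normal form of x_k t_p given by the multiplication
    matrix.  It is zero inside the order ideal and a border basis polynomial on
    its rim. *)
Definition rim k p : B := term_poly (termM k (t p)) - comb_poly (col p (A k)).

Definition var_poly k : B := term_poly U_(k).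

Lemma term_poly_termM k u : term_poly (termM k u) = var_poly k * term_poly u.
Proof. by rewrite /var_poly /term_poly !termME !mnmE !exprD polyCM; ring. Qed.

Lemma comb_poly_delta m : comb_poly (delta_mx m 0) = term_poly (t m).
Proof.
rewrite /comb_poly (bigD1 m) //= big1 ?addr0 => [|i ne]; rewrite mxE ?eqxx /polyCC.
  by rewrite mul1r.
by rewrite (negPf ne) mul0r.
Qed.

Lemma rim_in k p m : termM k (t p) = t m -> rim k p = 0.
Proof.
by move=> e; rewrite /rim (col_border_mulmx_in _ e) comb_poly_delta e subrr.
Qed.

Lemma rim_out k p n : termM k (t p) = b n -> rim k p = border_poly n.
Proof. by move=> e; rewrite /rim (col_border_mulmx_out _ e) e. Qed.

(** Only the entries of v in rows p with x_k t_p in the border occur in the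
    error term; this is why the syzygies below involve exposed coefficients
    only. *)
Lemma var_poly_comb_poly k v :
  var_poly k * comb_poly v = comb_poly (A k *m v)
    + \sum_p polyCC (v p 0) * rim k p.
Proof.
under [X in _ = _ + X]eq_bigr => p _ do rewrite mulrBr.
rewrite sumrB addrC -addrA.
have -> : \sum_p polyCC (v p 0) * comb_poly (col p (A k))
          = comb_poly (A k *m v).
  under eq_bigr => p _ do rewrite mulr_sumr.
  rewrite exchange_big; apply: eq_bigr => i _ /=.
  rewrite mxE /polyCC !rmorph_sum mulr_suml; apply: eq_bigr => p _.
  by rewrite mxE /= !polyCM mulrA [_ * (A k i p)%:P%:P]mulrC.
rewrite addNr addr0 mulr_sumr; apply: eq_bigr => p _.
by rewrite term_poly_termM mulrCA.
Qed.

(** The two syzygies attached to neighbours.  They hold because the columns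
    of c satisfy the natural equations, which make the parts in the span of the
    order ideal cancel. *)
Lemma border_poly_next_door k j j' : b j = termM k (b j') ->
  border_poly j = var_poly k * border_poly j'
    + \sum_p polyCC (c p j') * rim k p.
Proof.
move=> e; rewrite /border_poly mulrBr var_poly_comb_poly.
rewrite -(col_next_door e) e term_poly_termM.
under [X in _ = _ - (_ + X) + _]eq_bigr => p _ do rewrite mxE.
ring.
Qed.

Lemma border_poly_across_rim k l p j j' :
  b j = termM k (t p) -> b j' = termM l (t p) ->
  var_poly l * border_poly j = var_poly k * border_poly j'
    + \sum_p polyCC (c p j') * rim k p - \sum_p polyCC (c p j) * rim l p.
Proof.
move=> e e'; rewrite /border_poly !mulrBr !var_poly_comb_poly.
rewrite (col_across_rim e e') e e'.
rewrite -!term_poly_termM termMC.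
under [X in _ = _ - (_ + X) + _ - _]eq_bigr => q _ do rewrite mxE.
under [X in _ - (_ + X) = _]eq_bigr => q _ do rewrite mxE.
ring.
Qed.

Lemma var_poly0E : var_poly 0 = 'X.
Proof. by rewrite /var_poly /term_poly !mnm1E /= expr0 mulr1 expr1. Qed.

Lemma var_poly1E : var_poly 1 = 'X%:P.
Proof. by rewrite /var_poly /term_poly !mnm1E /= expr0 mul1r expr1. Qed.

Lemma coef_term_poly u a d : (term_poly u)`_a`_d = (u == xyterm a d)%:R.
Proof.
rewrite /term_poly coefMC coefXn.
have -> : (u == xyterm a d) = (a == u 0) && (d == u 1).
  apply/eqP/andP => [->|[/eqP -> /eqP ->]]; last exact: xytermE.
  by rewrite xyterm0 xyterm1.
case: (a == u 0); last by rewrite mul0r coef0.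
by rewrite mul1r coefXn.
Qed.

Lemma coef_comb_poly v i : (comb_poly v)`_(t i 0)`_(t i 1) = v i 0.
Proof.
rewrite /comb_poly !coef_sum (bigD1 i) //= big1 => [|p ne].
  by rewrite addr0 /polyCC !coefCM coef_term_poly -xytermE eqxx mulr1.
rewrite /polyCC !coefCM coef_term_poly -xytermE (inj_eq (@oterm_inj _ _ O)).
by rewrite (negPf ne) mulr0.
Qed.

Lemma coef_border_poly i j : (border_poly j)`_(t i 0)`_(t i 1) = - c i j.
Proof.
rewrite /border_poly !coefB coef_comb_poly mxE coef_term_poly -xytermE.
case: eqP => [e|_]; last by rewrite sub0r.
by have := bterm_notin O j; rewrite e mem_tnth.
Qed.

(* The data and properties provided by column_tops. *)
Section Columns.

Variables (w : nat) (j0 : 'I_nu) (top : 'I_w -> 'I_nu).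
Hypothesis ej0 : b j0 = xyterm w 0.
Hypothesis lt_w : forall u, u \in oterm O -> (u 0%R < w)%N.
Hypothesis topP : forall a, exists2 u, u \in oterm O & b (top a) = termM 1 u.
Hypothesis top_onto :
  forall j u, u \in oterm O -> b j = termM 1 u -> exists a, j = top a.
Hypothesis flat_eq : forall j, b j 1 = 0%N -> j = j0.

Definition yspan (f : B) : Prop :=
  exists (s : 'I_w -> {poly R}) (s0 : {poly R}),
  [/\ forall a, s a \is a polyOver S, s0 \is a polyOver S &
   f = \sum_a (s a)%:P * border_poly (top a) + s0%:P * border_poly j0].

Lemma yspanD f g : yspan f -> yspan g -> yspan (f + g).
Proof.
move=> [s [s0 [sS s0S ->]]] [r [r0 [rS r0S ->]]].
exists (fun a => s a + r a), (s0 + r0); split=> [a||]; rewrite ?rpredD //.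
rewrite addrACA -big_split polyCD mulrDl; congr (_ + _).
by apply: eq_bigr => a _; rewrite polyCD mulrDl.
Qed.

Lemma yspanZ d f : d \is a polyOver S -> yspan f -> yspan (d%:P * f).
Proof.
move=> dS [s [s0 [sS s0S ->]]].
exists (fun a => d * s a), (d * s0); split=> [a||]; rewrite ?rpredM //.
rewrite mulrDr mulr_sumr polyCM mulrA; congr (_ + _).
by apply: eq_bigr => a _; rewrite polyCM mulrA.
Qed.

Lemma yspan0 : yspan 0.
Proof.
exists (fun _ => 0), 0; split=> *; rewrite ?rpred0 //.
by rewrite mul0r addr0 big1 // => a _; rewrite mul0r.
Qed.

Lemma yspanB f g : yspan f -> yspan g -> yspan (f - g).
Proof.
move=> hf hg; apply: yspanD => //; have -> : - g = (-1)%:P * g.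
  by rewrite polyCN mulN1r.
by apply: yspanZ => //; rewrite rpredN rpred1.
Qed.

Lemma yspan_j0 : yspan (border_poly j0).
Proof.
exists (fun _ => 0), 1; split=> *; rewrite ?rpred0 ?rpred1 //.
by rewrite mul1r big1 ?add0r // => a _; rewrite mul0r.
Qed.

Lemma yspan_top a : yspan (border_poly (top a)).
Proof.
exists (fun a' => (a' == a)%:R), 0; split=> [a'||]; rewrite ?rpred_nat ?rpred0 //.
rewrite mul0r addr0 (bigD1 a) //= eqxx mul1r big1 ?addr0 // => a' /negPf ->.
by rewrite mul0r.
Qed.

Lemma yspan_sum_rim k j :
  (forall p n, termM k (t p) = b n -> c p j \in S /\ yspan (border_poly n)) ->
  yspan (\sum_p polyCC (c p j) * rim k p).
Proof.
move=> h; apply: (big_ind yspan); [exact: yspan0 | exact: yspanD |] => p _.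
have [[m em]|[n en]] := termM_otermP k (mem_tnth p (oterm O)).
  by rewrite (rim_in em) mulr0; apply: yspan0.
rewrite (rim_out en); have [cS hn] := h _ _ en.
by apply: yspanZ => //; rewrite polyOverC.
Qed.

Lemma dir_exposed_in l i j : dir_exposed O l i j -> c i j \in S.
Proof. by move=> h; apply: exposed_in; exists l. Qed.

(** A border term which is neither a column top nor x^w lies on a vertical
    wall, and the next-door syzygy with the border term below it leads down the
    wall.  The rims of this syzygy are in direction y, so they are column
    tops. *)
Lemma yspan_border_poly n : yspan (border_poly n).
Proof.
have [m] := ubnP (b n 1); elim: m n => // m IHm n; rewrite ltnS => le_m.
have [/flat_eq ->|] := eqVneq (b n 1) 0%N; first exact: yspan_j0.
rewrite -lt0n => n1; pose u := xyterm (b n 0) (b n 1).-1.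
have en : b n = termM 1 u by rewrite termM1_xyterm prednK // -xytermE.
have [uO|nuO] := boolP (u \in oterm O).
  by have [a ->] := top_onto uO en; apply: yspan_top.
have [k [v vO ev]] := btermE O n.
have k0 : k = 0.
  apply: (@ord2_neq 0 1) => //; apply: contraTneq vO => k1; move: ev.
  by rewrite en k1 => /termM_inj <-.
have [n' en'] : exists n', u = b n'.
  have eu : u = termM 0 (xyterm (v 0) (v 1).-1).
    by rewrite termM0_xyterm /u ev k0 !termME /= add1n add0n.
  rewrite eu; apply: termM_bterm; rewrite -?eu //.
  by rewrite [v]xytermE in vO; apply: xyterm_down vO; rewrite ?leq_pred.
have enn' : b n = termM 1 (b n') by rewrite -en'.
rewrite (border_poly_next_door enn'); apply: yspanD.
  rewrite var_poly1E; apply: yspanZ; first by rewrite polyOverX.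
  apply: IHm; apply: leq_trans le_m.
  by rewrite enn' termME /= add1n.
apply: yspan_sum_rim => p q e; split.
  apply: (@dir_exposed_in 1); split; first by rewrite e mem_tnth.
  by exists n; left.
have [a ->] := top_onto (mem_tnth p (oterm O)) (esym e).
exact: yspan_top.
Qed.

(** To the right of a column top the border has a neighbour, next-door or
    across the rim, whose syzygy expresses the product with x. *)
Lemma yspan_xtop a : yspan ('X * border_poly (top a)).
Proof.
rewrite -var_poly0E; have [u uO eu] := topP a.
have /tnthP[p ep] := uO.
have [j' [ej'|ej']] := border_step 0 uO eu.
  have -> : var_poly 0 * border_poly (top a)
            = border_poly j' - \sum_p polyCC (c p (top a)) * rim 0 p.
    by rewrite (border_poly_next_door ej') addrK.
  apply: yspanB; first exact: yspan_border_poly.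
  apply: yspan_sum_rim => q n e; split; last exact: yspan_border_poly.
  apply: (@dir_exposed_in 0); split; first by rewrite e mem_tnth.
  by exists j'; left.
have across : termM 1 (b j') = termM 0 (b (top a)) by rewrite eu ej' termMC.
rewrite ep in eu ej'.
rewrite (border_poly_across_rim eu ej'); apply: yspanB; first apply: yspanD.
- by rewrite var_poly1E; apply: yspanZ (yspan_border_poly _); rewrite polyOverX.
- apply: yspan_sum_rim => q n e; split; last exact: yspan_border_poly.
  apply: (@dir_exposed_in 1); split; first by rewrite e mem_tnth.
  by exists (top a); right; exists 0.
- apply: yspan_sum_rim => q n e; split; last exact: yspan_border_poly.
  apply: (@dir_exposed_in 0); split; first by rewrite e mem_tnth.
  by exists j'; right; exists 1.
Qed.

Lemma size_comb_poly v : (size (comb_poly v) <= w)%N.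
Proof.
apply: leq_trans (size_sum _ _ _) _; apply/bigmax_leqP => i _.
rewrite /polyCC mul_polyC; apply: leq_trans (size_scale_leq _ _) _.
rewrite /term_poly mulrC mul_polyC; apply: leq_trans (size_scale_leq _ _) _.
by rewrite size_polyXn lt_w // mem_tnth.
Qed.

Lemma term_poly_j0 : term_poly (b j0) = 'X^w.
Proof. by rewrite ej0 /term_poly xyterm0 xyterm1 expr0 mulr1. Qed.

Lemma size_border_poly_j0 : size (border_poly j0) = w.+1.
Proof.
rewrite /border_poly term_poly_j0 size_polyDl size_polyXn //.
by rewrite size_polyN ltnS size_comb_poly.
Qed.

Lemma border_poly_j0_monic : border_poly j0 \is monic.
Proof.
rewrite monicE /border_poly term_poly_j0 lead_coefDl ?lead_coefXn //.
by rewrite size_polyXn size_polyN ltnS size_comb_poly.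
Qed.

(** Cayley-Hamilton for multiplication by y, applied to the term 1: the rims
    are the amounts by which the terms fail to be an eigenvector of its matrix
    with eigenvalue y. *)
Lemma monic_y_combination : exists (d : {poly R}) (r : 'I_mu -> {poly R}),
  d \is monic /\ d%:P = \sum_p (r p)%:P * rim 1 p.
Proof.
pose N := (A 1)^T.
pose E := map_mx polyC (char_poly_mx N) : 'M[B]_mu.
have ET : E *m (\col_i term_poly (t i)) = \col_i rim 1 i.
  apply/matrixP => i j; rewrite !mxE /rim term_poly_termM var_poly1E.
  under eq_bigr => m _ do rewrite !mxE polyCB mulrBl.
  rewrite sumrB; congr (_ - _).
    rewrite (bigD1 i) //= big1 ?addr0 => [|m ne]; first by rewrite eqxx mulr1n.
    by rewrite eq_sym (negPf ne) mulr0n mul0r.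
  by rewrite /comb_poly; apply: eq_bigr => m _; rewrite !mxE.
have /tnthP[i1 ei1] := one_in_oterm O.
exists (char_poly N), (fun p => \adj (char_poly_mx N) i1 p).
split; first exact: char_poly_monic.
have /(congr1 (fun T : 'cV[B]_mu => T i1 0)) :=
  congr1 (mulmx (map_mx polyC (\adj (char_poly_mx N)))) ET.
rewrite mulmxA -map_mxM mul_adj_mx map_scalar_mx mul_scalar_mx !mxE -ei1.
have -> : term_poly (xyterm 0 0) = 1.
  by rewrite /term_poly xyterm0 xyterm1 !expr0 mulr1.
by rewrite mulr1 => ->; apply: eq_bigr => p _; rewrite !mxE.
Qed.

(** The explicit form of the Hilbert-Burch theorem: the border basis polynomial
    of x^w is the characteristic polynomial of a matrix over S[y]. *)
Lemma border_poly_over n : border_poly n \is a polyOver (poly_subring S).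
Proof.
have [s /fin_all_exists[s0 sP]] := fin_all_exists yspan_xtop.
pose M := \matrix_(a, a') s a a' : 'M[{poly R}]_w.
pose z := \adj (char_poly_mx M) *m (\col_a (s0 a)%:P) : 'cV[B]_w.
have MS i j : char_poly_mx M i j \is a polyOver (poly_subring S).
  have [sS _ _] := sP i; rewrite !mxE.
  apply: rpredB; last by rewrite polyOverC sS.
  by apply: rpredMn; apply: polyOverX.
have chiG a : char_poly M * border_poly (top a) = z a 0 * border_poly j0.
  have eG : char_poly_mx M *m (\col_a border_poly (top a))
            = border_poly j0 *: (\col_a (s0 a)%:P).
    rewrite mulmxBl mul_scalar_mx; apply/matrixP => i j; rewrite !mxE.
    have [_ _ ->] := sP i.
    rewrite addrC; under eq_bigr => a' _ do rewrite !mxE.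
    by rewrite addKr mulrC.
  have := congr1 (mulmx (\adj (char_poly_mx M))) eG.
  rewrite mulmxA mul_adj_mx mul_scalar_mx -scalemxAr.
  by move/matrixP/(_ a 0); rewrite !mxE [_ * border_poly j0]mulrC => ->.
have chi_span j : exists q, char_poly M * border_poly j = q * border_poly j0.
  have [r [r0 [_ _ ->]]] := yspan_border_poly j.
  exists (\sum_a (r a)%:P * z a 0 + char_poly M * r0%:P).
  rewrite mulrDr mulrDl mulrA; congr (_ + _).
  rewrite mulr_sumr mulr_suml; apply: eq_bigr => a _.
  by rewrite mulrCA chiG mulrA.
have chi_rim p : exists q, char_poly M * rim 1 p = q * border_poly j0.
  have [[m em]|[m em]] := termM_otermP 1 (mem_tnth p (oterm O)).
    by exists 0; rewrite (rim_in em) mulr0 mul0r.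
  by rewrite (rim_out em); apply: chi_span.
have [q qP] := fin_all_exists chi_rim.
have chiE : char_poly M = border_poly j0.
  have [d [r [md ed]]] := monic_y_combination.
  apply: (@monic_eq_of_multiple _ d _ _ (\sum_p (r p)%:P * q p)) => //.
  - exact: char_poly_monic.
  - exact: border_poly_j0_monic.
  - by rewrite size_char_poly size_border_poly_j0.
  - rewrite ed !mulr_suml; apply: eq_bigr => p _.
    by rewrite -!mulrA [rim 1 p * _]mulrC qP.
have topS a : border_poly (top a) \is a polyOver (poly_subring S).
  have -> : border_poly (top a) = z a 0.
    by apply/(monic_rreg border_poly_j0_monic); rewrite -chiG mulrC chiE.
  rewrite mxE rpred_sum // => i _; rewrite rpredM ?rpred_adj //.
  by have [_ s0S _] := sP i; rewrite mxE polyOverC.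
have [r [r0 [rS r0S ->]]] := yspan_border_poly n.
rewrite rpredD ?rpred_sum // => [a _|]; rewrite rpredM ?polyOverC //.
by rewrite -chiE rpred_det.
Qed.

End Columns.

(** Every O-border basis over R has its coefficients in any subring which
    contains the exposed ones. *)
Theorem exposed_generate_coefficients i j : c i j \in S.
Proof.
have [w [j0 [top [ej0 lt_w topP top_onto flat_eq]]]] := column_tops O.
have /polyOverP/(_ (t i 0))/polyOverP/(_ (t i 1)) :=
  border_poly_over ej0 lt_w topP top_onto flat_eq j.
by rewrite coef_border_poly rpredN.
Qed.

End BorderBasis.

(** * The coordinate ring and its basic indeterminates *)

Section CoordinateRing.

Variables (K : fieldType) (mu nu : nat) (O : order_ideal mu nu).
Local Notation t := (tnth (oterm O)).
Local Notation b := (tnth (bterm O)).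
Local Notation KC := {mpoly K[mu * nu]}.
Local Notation Cmx := (@Cmx K mu nu).

Lemma mulmatrixE r : mulmatrix K O r = border_mulmx O Cmx r.
Proof. by []. Qed.

Lemma residue_mulmatrix r :
  map_mx (@residue K mu nu O) (mulmatrix K O r)
    = border_mulmx O (map_mx (@residue K mu nu O) Cmx) r.
Proof.
apply/matrixP => i j; rewrite !mxE.
case: pickP => [m _|_]; first by rewrite rmorph_nat.
by case: pickP => [m _|_]; rewrite ?mxE ?rmorph0.
Qed.

Lemma residue_commutator i j : residue O (commutator K O i j) = 0.
Proof.
rewrite -[RHS](rmorph0 (@residue K mu nu O)); apply/eqP.
rewrite residueE subr0; apply/asboolP.
exists (fun ij => (ij == (i, j))%:R); rewrite (bigD1 (i, j)) //= eqxx mul1r.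
by rewrite big1 ?addr0 // => ij /negPf ->; rewrite mul0r.
Qed.

Lemma residue_mulmatrix_comm (c := map_mx (@residue K mu nu O) Cmx) :
  border_mulmx O c 0 *m border_mulmx O c 1 =
  border_mulmx O c 1 *m border_mulmx O c 0.
Proof.
rewrite -!residue_mulmatrix -!map_mxM; apply/eqP; rewrite -subr_eq0 -map_mxB.
by apply/eqP/matrixP => i j; rewrite mxE [RHS]mxE; apply: residue_commutator.
Qed.

Lemma residue_in_subalgebra (S : {pred coordinate_ring K O}) :
  GRing.subalg_closed S -> (forall i j, residue O (Cmx i j) \in S) ->
  forall x, x \in S.
Proof.
move=> subS CS x; have [p ->] := residue_surj x.
have [S1 Slin SM] := subS.
have S0 : 0 \in S by have := Slin (-1) _ _ S1 S1; rewrite scaleN1r addNr.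
elim/mpolyind: p => [|a m p _ _ IH]; first by rewrite rmorph0.
have -> : residue O (a *: 'X_[m] + p) = a *: residue O 'X_[m] + residue O p.
  by rewrite raddfD; congr (_ + _); apply: residue_is_scalable.
apply: Slin => //.
rewrite mpolyXE_id rmorph_prod; apply: (big_ind (fun y => y \in S)) => // i _.
have XS : residue O 'X_i \in S.
  by case/mxvec_indexP: i => i j; have := CS i j; rewrite mxE.
rewrite rmorphXn; elim: (m i) => [|n IHn]; first by rewrite expr0.
by rewrite exprS; apply: SM.
Qed.

Theorem exposed_generate :
  @generates_algebra K (coordinate_ring K O)
    (fun x => exists i j, exposed O i j /\ x = residue O (Cmx i j)).
Proof.
move=> S subS GS; apply: residue_in_subalgebra => // i j.
pose S' : subringClosed (coordinate_ring K O) :=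
  HB.pack S (GRing.isSubringClosed.Build _ S (GRing.subalg_closedBM subS)).
have := @exposed_generate_coefficients _ _ O _ _ S' residue_mulmatrix_comm _ i j.
rewrite [map_mx _ _ _ _]mxE; apply=> {}i {}j ex.
by rewrite mxE; apply: GS; exists i, j.
Qed.

Lemma mcoeffU_Cmx i j i0 j0 :
  (Cmx i j)@_U_(mxvec_index i0 j0) = ((i == i0) && (j == j0))%:R.
Proof.
rewrite mxE mcoeffXU; congr (_ %:R); congr nat_of_bool.
apply/eqP/andP => [/cast_ord_inj/enum_rank_inj[-> ->]|[/eqP-> /eqP->]] //.
Qed.

(** Linearly, multiplication by A_k moves c_ij to the row of x_k t_i: the
    indeterminates in A_k only contribute to the quadratic part. *)
Lemma mcoeffU_mulmatrix_col k i j i0 j0 :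
  ((mulmatrix K O k *m col j Cmx) i 0)@_U_(mxvec_index i0 j0) =
  ((t i == termM k (t i0)) && (j == j0))%:R.
Proof.
rewrite mxE raddf_sum /=.
have c0 m : (Cmx m j)@_0 = 0 by rewrite mxE mcoeffX mnm1_eq0.
under eq_bigr => m _ do
  rewrite mcoeffU_mul [col _ _ _ _]mxE c0 mulr0 add0r mulmatrix_coef0 mcoeffU_Cmx.
rewrite (bigD1 i0) //= eqxx big1 => [|m /negPf ->]; last by rewrite mulr0.
by rewrite addr0 -natrM mulnb.
Qed.

(** With b_j = x_l u and u in the order ideal, the neighbour of b_j in the
    other direction x_k makes c_ij exposed, unless x_k t_i = t_m; in that case
    c_ij has coefficient 1 or -1 in row m of the generator of this pair. *)
Lemma basic_exposed i j : basic K O i j -> exposed O i j.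
Proof.
move=> bas; have [l [u uO ej]] := btermE O j.
have [k kl] : exists k, k != l.
  by case: (eqVneq l 0) => [->|l0]; [exists 1 | exists 0; rewrite eq_sym].
have border_row : (forall m, termM k (t i) = t m -> exists2 p,
    natural_generator O p & p@_U_(mxvec_index i j) != 0 :> K) ->
    termM k (t i) \in bterm O.
  move=> h; have [[m em]|[n ->]] := termM_otermP k (mem_tnth i (oterm O)).
    have [p pn /eqP[]] := h m em; exact/linear_coef0/bas.
  exact: mem_tnth.
exists k; have [j' [ej'|ej']] := border_step k uO ej.
  have j'j : j' != j.
    by apply: contraNneq (termM_neq k (b j)) => e; rewrite -ej' e.
  split; last by exists j'; left.
  apply: border_row => m em.
  exists ((col j' Cmx - mulmatrix K O k *m col j Cmx) m 0).
    by left; exists j', j, k, m.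
  rewrite mxE [X in _ + X]mxE mcoeffB mcoeffU_mulmatrix_col.
  rewrite [col _ _ _ _]mxE mcoeffU_Cmx.
  by rewrite (negPf j'j) andbF em !eqxx sub0r oppr_eq0 oner_eq0.
have j'j : j' != j.
  apply: contraNneq kl => e; apply/eqP/(@termM_inj_var u).
  by rewrite /= -ej' -ej e.
split; last first.
  exists j'; right; exists l; split; first by rewrite eq_sym.
  by rewrite ej' ej termMC.
have /tnthP[p ep] := uO; rewrite ep in ej ej'.
apply: border_row => m em.
exists ((mulmatrix K O k *m col j Cmx - mulmatrix K O l *m col j' Cmx) m 0).
  right; exists j, j', l, k, m; split=> //.
  by split; [rewrite eq_sym | exists p].
rewrite mxE [X in _ + X]mxE mcoeffB !mcoeffU_mulmatrix_col (negPf j'j).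
by rewrite andbF em !eqxx subr0 oner_eq0.
Qed.

(** The column of t_p in the commutator compares the two ways from t_p to
    x_k x_l t_p.  If both x_k t_p and x_l t_p are in the order ideal they give
    the same vector; if one is, the border terms x_l t_p and x_k x_l t_p are
    next-door neighbours; if none is, these two border terms are across the
    rim. *)
Lemma commutator_natural k l p i : k != l ->
  let A := mulmatrix K O in
  let e := (A l *m A k) i p - (A k *m A l) i p in
  [\/ e = 0, natural_generator O e | natural_generator O (- e)].
Proof.
move=> kl A e.
have entry (X : 'M[KC]_mu) : X i p = (col p X) i 0 by rewrite mxE.
have half k' l' m j' :
    k' != l' -> termM k' (t p) = t m -> termM l' (t p) = b j' ->
    natural_generator O ((A l' *m A k') i p - (A k' *m A l') i p).
  move=> kl' em ej'.
  have [j ej] : exists j, termM l' (t m) = b j.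
    apply: termM_bterm; first exact: mem_tnth.
    rewrite -em termMC ej'; apply: contra (bterm_notin O j').
    exact: oterm_termM.
  left; exists j, j', k', i; split.
    by rewrite /next_door -ej -em termMC ej'.
  rewrite entry (entry (A k' *m _)) /A !mulmatrixE (col_mul_border_in _ _ em).
  rewrite (col_border_mulmx_out _ ej) (col_mul_border_out _ _ ej').
  by rewrite [RHS]mxE [X in _ = _ + X]mxE.
have [[m em]|[j ej]] := termM_otermP k (mem_tnth p (oterm O));
  have [[m' em']|[j' ej']] := termM_otermP l (mem_tnth p (oterm O)).
- constructor 1; rewrite /e entry (entry (A k *m _)) /A !mulmatrixE.
  rewrite (col_mul_border_in _ _ em) (col_mul_border_in _ _ em').
  have sq : termM l (t m) = termM k (t m') by rewrite -em -em' termMC.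
  have [[q eq]|[n en]] := termM_otermP l (mem_tnth m (oterm O)).
    have eq' : termM k (t m') = t q by rewrite -sq.
    by rewrite (col_border_mulmx_in _ eq) (col_border_mulmx_in _ eq') subrr.
  have en' : termM k (t m') = b n by rewrite -sq.
  by rewrite (col_border_mulmx_out _ en) (col_border_mulmx_out _ en') subrr.
- by constructor 2; apply: half em ej'.
- by constructor 3; rewrite opprB; apply: half em' ej; rewrite eq_sym.
- constructor 2; right; exists j, j', k, l, i.
  split; first by split=> //; exists p.
  rewrite /e entry (entry (A k *m _)) /A !mulmatrixE.
  rewrite (col_mul_border_out _ _ ej) (col_mul_border_out _ _ ej').
  by rewrite [RHS]mxE [X in _ = _ + X]mxE.
Qed.

(** Commutator entries vanish at 0, so the linear part of an element of the
    ideal is a combination over K of their linear parts. *)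
Lemma basic_border_ideal i j f :
  basic K O i j -> f \in @border_ideal K mu nu O -> f@_U_(mxvec_index i j) = 0.
Proof.
move=> bas /asboolP[a ->]; rewrite raddf_sum big1 //= => -[i' p] _ /=.
rewrite mcoeffU_mul commutator_coef0 mulr0 add0r.
suff -> : (commutator K O i' p)@_U_(mxvec_index i j) = 0 by rewrite mulr0.
have -> : commutator K O i' p = (mulmatrix K O 0 *m mulmatrix K O 1) i' p
                              - (mulmatrix K O 1 *m mulmatrix K O 0) i' p.
  by rewrite mxE [X in _ + X]mxE.
have [->|nat|nat] := @commutator_natural 1 0 p i' isT.
- exact: mcoeff0.
- exact/linear_coef0/bas.
- by apply/eqP; rewrite -oppr_eq0 -mcoeffN; apply/eqP/linear_coef0/bas.
Qed.

Theorem basic_not_separating i j (s : nat) (Z : s.-tuple ('I_mu * 'I_nu)) :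
  basic K O i j -> separating_reembedding K O Z -> (i, j) \notin Z.
Proof.
move=> bas [f [le [fI _ lt]]]; apply/negP => /tnthP[r er].
have [+ _] := lt r; rewrite -er mcoeff_msupp => /eqP; apply.
exact: basic_border_ideal.
Qed.

End CoordinateRing.

Theorem corollary6p5 (K : fieldType) (mu nu : nat) (O : order_ideal mu nu) :
  @generates_algebra K (coordinate_ring K O)
    (fun x => exists i j, exposed O i j /\ x = residue O (@Cmx K mu nu i j))
  /\
  (forall (i : 'I_mu) (j : 'I_nu), basic K O i j ->
     exposed O i j /\
     forall (s : nat) (Z : s.-tuple ('I_mu * 'I_nu)),
       uniq Z -> separating_reembedding K O Z -> (i, j) \notin Z).
Proof.
split; first exact: exposed_generate.
move=> i j bas; split; first exact: basic_exposed bas.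
by move=> s Z _; apply: basic_not_separating.
Qed.
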